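(* Let $\Omega\subset\mathbb{C}$ be a Jordan domain which is starlike, or a domain of type $\ast$. Let $f\in A(\Omega)$. Then the antiderivative of $f$ also belongs to $A(\Omega)$.
   Context: A Jordan domain is the bounded domain enclosed by a Jordan (simple closed) curve in $\mathbb{C}$. $\Omega$ is starlike if there is $z_0\in\Omega$ such that the segment $[z_0,z]$ is contained in $\Omega$ for every $z\in\Omega$. A domain of type $\ast$ is a set $\Omega=\{(x,y): 0<x<1,\ c<y<\tau(x)\}$ (with $\mathbb{C}$ identified with $\mathbb{R}^2$), where $\tau:[0,1]\to\mathbb{R}$ is a continuous function which is not of bounded variation and $c<\min_{x\in[0,1]}\tau(x)$. $A(\Omega)$ is the set of functions holomorphic on $\Omega$ which extend continuously to $\overline{\Omega}$. An antiderivative of $f$ on $\Omega$ is a holomorphic $F$ on $\Omega$ with $F'=f$; it is unique up to an additive constant, which does not affect the conclusion. *)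

(* Defs.v *)
From mathcomp Require Import all_boot all_order all_algebra.
From mathcomp Require Import all_classical all_reals all_analysis.
From mathcomp Require Import complex.

Set Implicit Arguments.
Unset Strict Implicit.
Unset Printing Implicit Defensive.

Import Order.TTheory GRing.Theory Num.Theory.
Import numFieldNormedType.Exports.

Local Open Scope classical_set_scope.
Local Open Scope ring_scope.
Local Open Scope complex_scope.

(* The topology and the normed space structure of the complex numbers are
   found on the alias [R[i]^o] (the field as a normed space over itself), not
   on [R[i]]. In particular [derivable f z 1] for [f : R[i]^o -> R[i]^o] is
   differentiability in the complex sense. *)

Definition jordan_curve (R : realType) (J : set R[i]^o) : Prop :=
  exists gamma : R -> R[i]^o,
    [/\ {within `[0, 1], continuous gamma},
        gamma 0 = gamma 1,
        {in `[0, 1[ &, injective gamma} &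
        J = gamma @` `[0, 1]].

(* The domain enclosed by J is the bounded connected component of the
   complement of J. *)
Definition jordan_domain (R : realType) (Omega : set R[i]^o) : Prop :=
  exists J : set R[i]^o,
    [/\ jordan_curve J,
        exists2 w, (~` J) w & Omega = connected_component (~` J) w &
        bounded_set Omega].

Definition starlike (R : realType) (Omega : set R[i]^o) : Prop :=
  exists2 z0, Omega z0 &
    forall z, Omega z ->
      forall t : R, 0 <= t <= 1 -> Omega (z0 + t%:C * (z - z0)).

Definition type_star (R : realType) (Omega : set R[i]^o) : Prop :=
  exists (tau : R -> R) (c : R),
    [/\ {within `[0, 1], continuous tau},
        ~ bounded_variation 0 1 tau,
        forall x : R, x \in `[0, 1] -> c < tau x &
        Omega = [set z | 0 < complex.Re z < 1
                         /\ c < complex.Im z < tau (complex.Re z)]].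

Definition holomorphic_on (R : realType) (Omega : set R[i]^o)
    (f : R[i]^o -> R[i]^o) : Prop :=
  forall z, Omega z -> derivable f z 1.

(* Functions on Omega are represented by total functions whose values outside
   Omega are irrelevant; hence the continuous extension is another function. *)
Definition A_of (R : realType) (Omega : set R[i]^o)
    (f : R[i]^o -> R[i]^o) : Prop :=
  holomorphic_on Omega f /\
  exists2 g : R[i]^o -> R[i]^o,
    {within closure Omega, continuous g} &
    forall z, Omega z -> g z = f z.

Definition antiderivative_on (R : realType) (Omega : set R[i]^o)
    (f F : R[i]^o -> R[i]^o) : Prop :=
  holomorphic_on Omega F /\ forall z, Omega z -> 'D_1 F z = f z.

(* Main.v *)
(* Write [z] in [Omega] as the end of a segment [rho z, z] in [Omega], where
   [rho] is affine, 1-Lipschitz and maps [Omega] to a convex part [L] of [Omega]: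
   the star centre if [Omega] is starlike, a horizontal segment below the graph
   if [Omega] is of type [*]. Goursat's bisection argument, applied to the images
   of the unit square under maps [A + s B + t C + s t D], shows that
   integrating [f] along [p0, rho z] and then along [rho z, z] gives a primitive.
   Since [closure Omega] is compact, [f] is bounded and uniformly continuous on
   [Omega]. The mean value inequality for
   [t |-> F (rho z + t (z - rho z)) - F (rho w + t (w - rho w))] then shows that
   every primitive [F] is uniformly continuous on [Omega], hence extends to
   [closure Omega]. *)
Require Import Defs.
From mathcomp Require Import all_boot all_order all_algebra.
From mathcomp Require Import all_classical all_reals all_analysis.
From mathcomp Require Import complex ring lra.
Import Order.TTheory GRing.Theory Num.Theory.
Import numFieldNormedType.Exports.

Set Implicit Arguments.
Unset Strict Implicit.
Unset Printing Implicit Defensive.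

Local Open Scope classical_set_scope.
Local Open Scope ring_scope.
Local Open Scope complex_scope.

(** The norm of [R[i]^o] is itself complex-valued; [nc] is the modulus as an element of [R], so that
    estimates take place in a totally ordered field. *)
Local Notation nc := ComplexField.Normc.normc.

(** * The real modulus, with topology and complex derivatives in epsilon-delta form *)

Section RealNorm.
Variable R : realType.
Implicit Types (z w : R[i]) (A : set R[i]^o).

Lemma normrE z : `|z| = (nc z)%:C.
Proof. by case: z. Qed.

Lemma ncD z w : nc (z + w) <= nc z + nc w.
Proof. exact: le_normcD. Qed.

Lemma ncN z : nc (- z) = nc z.
Proof. exact: normcN. Qed.

Lemma ncM z w : nc (z * w) = nc z * nc w.
Proof. exact: ComplexField.Normc.normcM. Qed.

Lemma nc_ge0 z : 0 <= nc z.
Proof. by case: z => a b; apply: sqrtr_ge0. Qed.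

Lemma nc0 : nc (0 : R[i]) = 0.
Proof. exact: ComplexField.Normc.normc0. Qed.

Lemma ncB z w : nc (z - w) = nc (w - z).
Proof. by rewrite -opprB ncN. Qed.

Lemma nc_real (x : R) : nc x%:C = `|x|.
Proof. by rewrite /= expr0n /= addr0 sqrtr_sqr. Qed.

Lemma nc_gt0 z : z != 0 -> 0 < nc z.
Proof.
move=> z0; rewrite lt_neqAle nc_ge0 andbT eq_sym.
by apply: contra z0 => /eqP/ComplexField.Normc.eq0_normc ->.
Qed.

Lemma ReB z w : complex.Re (z - w) = complex.Re z - complex.Re w.
Proof. by case: z; case: w. Qed.

Lemma ImB z w : complex.Im (z - w) = complex.Im z - complex.Im w.
Proof. by case: z; case: w. Qed.

Lemma normRe_le z : `|complex.Re z| <= nc z.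
Proof. by case: z => a b /=; rewrite -sqrtr_sqr ler_wsqrtr// lerDl sqr_ge0. Qed.

Lemma normIm_le z : `|complex.Im z| <= nc z.
Proof. by case: z => a b /=; rewrite -sqrtr_sqr ler_wsqrtr// lerDr sqr_ge0. Qed.

Lemma nc_le_ReIm z : nc z <= `|complex.Re z| + `|complex.Im z|.
Proof.
case: z => a b /=; rewrite -[leRHS]ger0_norm ?addr_ge0//.
rewrite -sqrtr_sqr ler_wsqrtr//; rewrite sqrrD !real_normK ?num_real//.
by rewrite lerD2r lerDl mulrn_wge0// mulr_ge0.
Qed.

Lemma ncD3 (a b c : R[i]) : nc (a - c) <= nc (a - b) + nc (b - c).
Proof. by rewrite -[a - c](subrKA b) ncD. Qed.

Lemma nbhs_ncP z A :
  nbhs (z : R[i]^o) A <-> exists2 d : R, 0 < d & forall w, nc (w - z) < d -> A w.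
Proof.
split=> [/nbhs_ballP[e /= e0 eA]|[d d0 dA]].
  have /complex_realP[r re] : e \is Num.real by apply/gtr0_real.
  exists r => [|w wz]; first by rewrite -ltcR -re.
  by apply: eA; rewrite /ball /= normrE re ltcR ncB.
apply/nbhs_ballP; exists d%:C => /=; first by rewrite ltcR.
by move=> w; rewrite /ball /= normrE ltcR ncB; exact: dA.
Qed.

Lemma open_ncP A : open A <->
  forall z, A z -> exists2 d : R, 0 < d & forall w, nc (w - z) < d -> A w.
Proof.
rewrite openE; split=> oA z /oA; first by move/nbhs_ncP.
by move=> ?; apply/nbhs_ncP.
Qed.

Lemma closure_ncP A z :
  closure A z <-> forall d : R, 0 < d -> exists2 w, A w & nc (w - z) < d.
Proof.
split=> [cA d d0|H B /nbhs_ncP[d d0 dB]]; last first.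
  by have [w Aw wz] := H d d0; exists w; split => //; exact: dB.
have [|w [Aw wz]] := cA [set w | nc (w - z) < d]; first by apply/nbhs_ncP; exists d.
by exists w.
Qed.

Lemma within_continuous_ncP A (g : R[i]^o -> R[i]^o) :
  {within A, continuous g} <-> forall z, A z -> forall e : R, 0 < e ->
    exists2 d : R, 0 < d & forall w, A w -> nc (w - z) < d -> nc (g w - g z) < e.
Proof.
rewrite subspace_continuousP; split=> H z Az.
  move=> e e0; have /cvgrPdist_lt/(_ e%:C) := H z Az.
  rewrite ltcR => /(_ e0)/nbhs_ncP[d d0 dH].
  exists d => // w Aw /dH/(_ Aw); rewrite normrE ltcR ncB; exact.
apply/cvgrPdist_lt => e e0.
have /complex_realP[r re] : e \is Num.real by apply/gtr0_real.
have [|d d0 dH] := H z Az r; first by rewrite -ltcR -re.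
by apply/nbhs_ncP; exists d => // w wz Aw; rewrite normrE re ltcR ncB; exact: dH.
Qed.

(** The remainder form avoids dividing by [h], so [h = 0] is harmless and the bound can be composed
    with paths. *)
Definition cderiv (f : R[i] -> R[i]) z l := forall e : R, 0 < e ->
  exists2 d : R, 0 < d &
    forall h, nc h < d -> nc (f (z + h) - f z - l * h) <= e * nc h.

Lemma derivable_cderiv (f : R[i]^o -> R[i]^o) z :
  derivable f z 1 -> cderiv f z ('D_1 f z).
Proof.
move=> df e e0; have /cvgrPdist_lt/(_ e%:C) := df.
rewrite ltcR => /(_ e0)/nbhs_ncP[d d0 H].
exists d => // h hd; have [->|h0] := eqVneq h 0.
  by rewrite addr0 mulr0 subr0 subrr nc0 mulr0.
have := H h; rewrite subr0 => /(_ hd h0).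
rewrite normrE ltcR => /ltW; rewrite /derive; set L := lim _ => Hh.
have -> : f (z + h) - f z - L * h = (h^-1 *: (f (h *: (1:R[i]^o) + z) - f z) - L) * h.
  rewrite mulrBl /GRing.scale/= mulr1 mulrAC mulVf// mul1r.
  by rewrite (addrC h z).
by rewrite ncM ncB ler_wpM2r// nc_ge0.
Qed.

Lemma cderiv_is_derive (f : R[i]^o -> R[i]^o) z l :
  cderiv f z l -> derivable f z 1 /\ 'D_1 f z = l.
Proof.
move=> H.
have C : h^-1 *: (f (h *: (1:R[i]^o) + z) - f z) @[h --> (0 : R[i]^o)^'] --> (l : R[i]^o).
  apply/cvgrPdist_le => e e0.
  have /complex_realP[r re] : e \is Num.real by apply/gtr0_real.
  have r0 : 0 < r by rewrite -ltcR -re.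
  have [d d0 {}H] := H r r0.
  apply/nbhs_ncP; exists d => // h; rewrite subr0 => hd h0.
  rewrite normrE re lecR ncB.
  rewrite -(@ler_pM2r _ (nc h)) ?nc_gt0//.
  apply: le_trans (H h hd); rewrite -ncM mulrBl /GRing.scale/= mulr1 mulrAC.
  by rewrite mulVf// mul1r (addrC h z).
split; first by apply/cvg_ex; exists l.
exact/cvg_lim.
Qed.

(** Differentiability with tolerance 1 gives the local bound [(1 + nc l) * nc (w - z)] for the
    increment. *)
Lemma cderiv_continuous (f : R[i] -> R[i]) z l : cderiv f z l ->
  forall e : R, 0 < e ->
  exists2 d : R, 0 < d & forall w, nc (w - z) < d -> nc (f w - f z) < e.
Proof.
move=> H e e0; have [d d0 {}H] := H 1 ltr01.
have k0 : 0 < 1 + nc l by rewrite ltr_wpDr ?nc_ge0.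
exists (Num.min d (e / (1 + nc l))) => [|w].
  by rewrite lt_min d0 divr_gt0.
rewrite lt_min ltr_pdivlMr// => /andP[wd we].
have := H _ wd; rewrite (addrC z) subrK mul1r => H1.
apply: le_lt_trans we; rewrite mulrDr mulr1.
rewrite -[f w - f z](subrK (l * (w - z))); apply: le_trans (ncD _ _) _.
by rewrite lerD// ncM mulrC.
Qed.

End RealNorm.

(** * Derivatives of paths and integrals along segments *)

Section PathIntegral.
Variable R : realType.
Implicit Types (a b t e M : R) (z w l : R[i]) (P Q : R -> R[i]) (f g : R[i] -> R[i]).

(* [R[i]^o] is a normed space over [R[i]] but not over [R], so the derivative of
   a path is stated directly with [nc]. *)
Definition pderiv P (t : R) l := forall e : R, 0 < e ->
  exists2 d : R, 0 < d &
    forall h, `|h| < d -> nc (P (t + h) - P t - h%:C * l) <= e * `|h|.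

Lemma is_derive_eps (U : R -> R) (t u : R) :
  (forall e : R, 0 < e -> exists2 d : R, 0 < d &
    forall h, `|h| < d -> `|U (t + h) - U t - h * u| <= e * `|h|) ->
  is_derive t 1 U u.
Proof.
move=> H.
have C : h^-1 *: (U (h *: (1:R) + t) - U t) @[h --> (0 : R)^'] --> (u : R).
  apply/cvgrPdist_le => e e0; have [d d0 {}H] := H e e0.
  apply/nbhs_ballP; exists d => //= h; rewrite /ball/= sub0r normrN => hd h0.
  rewrite -(@ler_pM2r _ `|h|) ?normr_gt0//.
  apply: le_trans (H h hd); rewrite -normrM mulrBl /GRing.scale/= mulr1 mulrAC.
  by rewrite mulVf// mul1r -normrN opprB (addrC h t) (mulrC u).
by split; [apply/cvg_ex; exists u|exact/cvg_lim].
Qed.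

Lemma is_derive_epsP (U : R -> R) (t u e : R) : is_derive t 1 U u -> 0 < e ->
  exists2 d : R, 0 < d &
    forall h, `|h| < d -> `|U (t + h) - U t - h * u| <= e * `|h|.
Proof.
move=> [dU <-] e0; have /cvgrPdist_lt/(_ e e0)/nbhs_ballP[d /= d0 H] := dU.
exists d => // h hd; have [->|h0] := eqVneq h 0.
  by rewrite addr0 mul0r subr0 subrr normr0 mulr0.
have := H h; rewrite /ball/= sub0r normrN => /(_ hd h0)/ltW.
rewrite /derive; set L := lim _ => Hh.
have -> : U (t + h) - U t - h * L = (h^-1 *: (U (h *: (1:R) + t) - U t) - L) * h.
  by rewrite mulrBl /GRing.scale/= mulr1 mulrAC mulVf// mul1r (addrC h t) (mulrC L).
by rewrite normrM distrC ler_wpM2r.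
Qed.

Lemma pderiv_Re P t l : pderiv P t l ->
  is_derive t 1 (fun s => complex.Re (P s)) (complex.Re l).
Proof.
move=> H; apply: is_derive_eps => e /H[d d0 {}H]; exists d => // h /H.
apply: le_trans; apply: le_trans (normRe_le _).
by move: (P _) (P _) => [? ?] [? ?]; case: l {H} => [? ?] /=; rewrite mul0r subr0.
Qed.

Lemma pderiv_Im P t l : pderiv P t l ->
  is_derive t 1 (fun s => complex.Im (P s)) (complex.Im l).
Proof.
move=> H; apply: is_derive_eps => e /H[d d0 {}H]; exists d => // h /H.
apply: le_trans; apply: le_trans (normIm_le _).
by move: (P _) (P _) => [? ?] [? ?]; case: l {H} => [? ?] /=; rewrite mul0r addr0.
Qed.

Lemma pderiv_complex (U V : R -> R) (t u v : R) :
  is_derive t 1 U u -> is_derive t 1 V v ->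
  pderiv (fun s => U s +i* V s) t (u +i* v).
Proof.
move=> dU dV e e0; have e20 : 0 < e / 2 by rewrite divr_gt0.
have [d1 d10 H1] := is_derive_epsP dU e20.
have [d2 d20 H2] := is_derive_epsP dV e20.
exists (Num.min d1 d2); first by rewrite lt_min d10.
move=> h; rewrite lt_min => /andP[/H1 h1 /H2 h2].
apply: le_trans (nc_le_ReIm _) _; rewrite (splitr e) mulrDl /= !mul0r subr0 addr0.
exact: lerD.
Qed.

Lemma pderivB P Q t l l' : pderiv P t l -> pderiv Q t l' ->
  pderiv (fun s => P s - Q s) t (l - l').
Proof.
move=> dP dQ e e0; have e20 : 0 < e / 2 by rewrite divr_gt0.
have [d1 d10 H1] := dP _ e20; have [d2 d20 H2] := dQ _ e20.
exists (Num.min d1 d2); first by rewrite lt_min d10.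
move=> h; rewrite lt_min => /andP[/H1 h1 /H2 h2].
have -> : P (t + h) - Q (t + h) - (P t - Q t) - h%:C * (l - l') =
  (P (t + h) - P t - h%:C * l) - (Q (t + h) - Q t - h%:C * l') by ring.
apply: le_trans (ncD _ _) _; rewrite ncN (splitr e) mulrDl; exact: lerD.
Qed.

Lemma pderiv_affine P (a b t : R) l : pderiv P (a + t * b) l ->
  pderiv (fun s => P (a + s * b)) t (b%:C * l).
Proof.
(* Dividing by [|b| + 1] instead of [|b|] covers the case [b = 0]. *)
move=> dP e e0; have b0 : 0 < `|b| + 1 by rewrite ltr_wpDl.
have [d d0 H] := dP (e / (`|b| + 1)) (divr_gt0 e0 b0).
exists (d / (`|b| + 1)) => [|h]; first by rewrite divr_gt0.
rewrite ltr_pdivlMr// mulrDr mulr1 => hd.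
have hb : `|h * b| < d.
  by apply: le_lt_trans hd; rewrite normrM lerDl.
have := H _ hb; rewrite (_ : a + t * b + h * b = a + (t + h) * b); last by ring.
rewrite rmorphM /= -(mulrA h%:C) => /le_trans; apply.
rewrite normrM mulrA mulrAC ler_wpM2r// -mulrA ler_piMr ?(ltW e0)//.
by rewrite mulrC ler_pdivrMr// mul1r lerDl.
Qed.

Lemma pderiv_segment f z d t l : cderiv f (z + t%:C * d) l ->
  pderiv (fun s => f (z + s%:C * d)) t (l * d).
Proof.
move=> df e e0; have b0 : 0 < nc d + 1 by rewrite ltr_wpDl// nc_ge0.
have [r r0 H] := df (e / (nc d + 1)) (divr_gt0 e0 b0).
exists (r / (nc d + 1)) => [|h]; first by rewrite divr_gt0.
rewrite ltr_pdivlMr// mulrDr mulr1 => hd.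
have hb : nc (h%:C * d) < r.
  by apply: le_lt_trans hd; rewrite ncM nc_real lerDl.
have := H _ hb.
rewrite (_ : z + t%:C * d + h%:C * d = z + (t + h)%:C * d);
  last by rewrite rmorphD /=; ring.
rewrite mulrCA ncM nc_real => /le_trans; apply.
rewrite mulrCA [X in X <= _]mulrC ler_wpM2r// mulrAC ler_pdivrMr//.
by rewrite ler_wpM2l ?(ltW e0)// lerDl.
Qed.

(** The mean value theorem has no equality form for complex-valued paths; applying it to the real
    and imaginary parts separately costs the factor 2. *)
Lemma pderiv_mean P (l : R -> R[i]) M :
  (forall t, 0 <= t <= 1 -> pderiv P t (l t)) ->
  (forall t, 0 <= t <= 1 -> nc (l t) <= M) -> nc (P 1 - P 0) <= 2 * M.
Proof.
move=> dP lM.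
have mv (U u : R -> R) : (forall t, 0 <= t <= 1 -> is_derive t 1 U (u t)) ->
    (forall t, 0 <= t <= 1 -> `|u t| <= M) -> `|U 1 - U 0| <= M.
  move=> dU uM; have [||c] := @MVT_segment R U u 0 1 ler01.
  - by move=> x; rewrite in_itv/= => /andP[x0 x1]; apply: dU; rewrite !ltW.
  - apply: derivable_within_continuous => x; rewrite in_itv/= => x01.
    by have [] := dU x x01.
  by rewrite in_itv/= subr0 mulr1 => c01 ->; exact: uM.
apply: le_trans (nc_le_ReIm _) _; rewrite mulr_natl mulr2n; apply: lerD.
  rewrite ReB; apply: (mv (@complex.Re R \o P) (@complex.Re R \o l)) => t t01.
    exact/pderiv_Re/dP.
  exact: le_trans (normRe_le _) (lM t t01).
rewrite ImB; apply: (mv (@complex.Im R \o P) (@complex.Im R \o l)) => t t01.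
  exact/pderiv_Im/dP.
exact: le_trans (normIm_le _) (lM t t01).
Qed.

(** Precomposing [u] with the clamp [cl] onto [[0, 1]] makes it continuous everywhere. Integrating
    over the larger interval [[-1, 2]] then puts 0 and 1 in the interior, where the fundamental
    theorem gives two-sided derivatives. *)
Lemma real_primitive (u : R -> R) :
  (forall t, 0 <= t <= 1 -> {for t, continuous u}) ->
  exists U : R -> R, forall t, 0 <= t <= 1 -> is_derive t 1 U (u t).
Proof.
move=> cu; pose cl t : R := Num.max 0 (Num.min 1 t).
have cl01 t : 0 <= cl t <= 1.
  by rewrite /cl le_max lexx /= ge_max ler01 /= ge_min lexx.
have clE t : 0 <= t <= 1 -> cl t = t.
  by move=> /andP[t0 t1]; rewrite /cl (min_idPr _)// (max_idPr _).
have ccl : continuous cl.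
  move=> t; apply: (@continuous_max _ _ (fun=> 0)); first exact: cvg_cst.
  by apply: (@continuous_min _ _ (fun=> 1)); [exact: cvg_cst|exact: cvg_id].
have cucl : continuous (u \o cl).
  by move=> t; apply: continuous_comp; [exact: ccl|exact/cu/cl01].
have iu : lebesgue_measure.-integrable `[(-1 : R), 2] (EFin \o (u \o cl)).
  apply: continuous_compact_integrable; first exact: segment_compact.
  exact: continuous_subspaceT.
pose U x := (\int[lebesgue_measure]_(t in `[-1, x]) ((u \o cl) t))%R.
exists U => t /[dup] t01 /andP[t0 t1].
have t2 : t < 2 by apply: le_lt_trans t1 _; rewrite ltr1n.
have t3 : -1 < t by apply: lt_le_trans t0; rewrite ltrN10.
have [dU UE] := continuous_FTC1_closed t2 iu t3 (cucl t).
by split => //; rewrite -derive1E UE /= clE.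
Qed.

Definition ccont f z := forall e : R, 0 < e ->
  exists2 d : R, 0 < d & forall w, nc (w - z) < d -> nc (f w - f z) < e.

(* [v] is the integral of [f] along the segment from [z] to [w]; it is defined
   through a primitive of the integrand, so that additivity and the norm bound
   follow from the mean value theorem. *)
Definition segint f z w v := exists2 P : R -> R[i],
  forall t, 0 <= t <= 1 -> pderiv P t (f (z + t%:C * (w - z)) * (w - z)) &
  v = P 1 - P 0.

Lemma segint_ex f z w :
  (forall t, 0 <= t <= 1 -> ccont f (z + t%:C * (w - z))) ->
  exists v, segint f z w v.
Proof.
move=> cf; pose g (t : R) := f (z + t%:C * (w - z)) * (w - z).
have gc t (e : R) : 0 <= t <= 1 -> 0 < e -> exists2 d : R, 0 < d &
    forall s, `|t - s| < d -> nc (g t - g s) < e.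
  move=> t01 e0; have b0 : 0 < nc (w - z) + 1 by rewrite ltr_wpDl// nc_ge0.
  have [d d0 H] := cf t t01 (e / (nc (w - z) + 1)) (divr_gt0 e0 b0).
  exists (d / (nc (w - z) + 1)) => [|s]; first by rewrite divr_gt0.
  rewrite ltr_pdivlMr// => sd.
  rewrite /g -mulrBl ncM (ncB (f _)).
  have : nc (f (z + s%:C * (w - z)) - f (z + t%:C * (w - z))) < e / (nc (w - z) + 1).
    apply: H; apply: le_lt_trans sd.
    have -> : z + s%:C * (w - z) - (z + t%:C * (w - z)) = (s - t)%:C * (w - z).
      by rewrite rmorphB/=; ring.
    by rewrite ncM nc_real distrC ler_wpM2l// lerDl.
  rewrite ltr_pdivlMr// => H1; apply: le_lt_trans H1.
  by rewrite ler_wpM2l ?nc_ge0// lerDl.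
have [|U dU] := @real_primitive (@complex.Re R \o g).
  move=> t t01; apply/cvgrPdist_lt => e e0; have [d d0 H] := gc t e t01 e0.
  apply/nbhs_ballP; exists d => //= s /H; apply: le_lt_trans.
  by rewrite -ReB; exact: normRe_le.
have [|V dV] := @real_primitive (@complex.Im R \o g).
  move=> t t01; apply/cvgrPdist_lt => e e0; have [d d0 H] := gc t e t01 e0.
  apply/nbhs_ballP; exists d => //= s /H; apply: le_lt_trans.
  by rewrite -ImB; exact: normIm_le.
exists (U 1 +i* V 1 - U 0 +i* V 0), (fun t => U t +i* V t) => // t t01.
have := pderiv_complex (dU t t01) (dV t t01).
by rewrite /= -/(g t); case: (g t).
Qed.

Lemma segint_norm f z w v M : segint f z w v ->
  (forall t, 0 <= t <= 1 -> nc (f (z + t%:C * (w - z))) <= M) ->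
  nc v <= 2 * (M * nc (w - z)).
Proof.
move=> [P dP ->] fM; apply: (pderiv_mean dP) => t t01.
by rewrite ncM ler_wpM2r ?nc_ge0//; exact: fM.
Qed.

Lemma segintB f g z w v v' : segint f z w v -> segint g z w v' ->
  segint (fun x => f x - g x) z w (v - v').
Proof.
move=> [P dP ->] [Q dQ ->]; exists (fun t => P t - Q t); last by ring.
by move=> t t01; rewrite mulrBl; exact: pderivB (dP _ _) (dQ _ _).
Qed.

(** The difference of the two values is an integral of the zero function, which [segint_norm] bounds
    by 0. *)
Lemma segint_uniq f z w v v' : segint f z w v -> segint f z w v' -> v = v'.
Proof.
move=> I I'; have := segint_norm (segintB I I') (M := 0).
rewrite mul0r mulr0 => H; apply/eqP; rewrite -subr_eq0.
apply/eqP/ComplexField.Normc.eq0_normc/eqP; rewrite eq_le nc_ge0 andbT.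
by apply: H => t _; rewrite subrr nc0.
Qed.

Lemma segint_primitive f g z w :
  (forall t, 0 <= t <= 1 -> cderiv f (z + t%:C * (w - z)) (g (z + t%:C * (w - z)))) ->
  segint g z w (f w - f z).
Proof.
move=> df; exists (fun t => f (z + t%:C * (w - z))).
  by move=> t t01; apply: pderiv_segment; exact: df.
by rewrite mul1r mul0r addr0 (addrC z) subrK.
Qed.

(** The primitive on the whole segment, reparametrised on each half, serves for both halves. *)
Lemma segint_split f z w v : segint f z w v ->
  exists2 v1, segint f z ((z + w) / 2) v1 & segint f ((z + w) / 2) w (v - v1).
Proof.
move=> [P dP ->]; exists (P 2^-1 - P 0).
  exists (fun t => P (0 + t * 2^-1)); last by rewrite mul1r mul0r !add0r.
  move=> t t01.
  have -> : (z + w) / 2 - z = (2^-1 : R)%:C * (w - z).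
    by rewrite rmorphV ?unitfE ?pnatr_eq0//= rmorph_nat; field.
  have -> : z + t%:C * ((2^-1 : R)%:C * (w - z)) = z + (0 + t * 2^-1)%:C * (w - z).
    by rewrite add0r rmorphM /= mulrA.
  rewrite mulrCA; apply: pderiv_affine.
  apply: dP; lra.
exists (fun t => P (2^-1 + t * 2^-1)); last first.
  by rewrite mul1r mul0r addr0 (_ : 2^-1 + 2^-1 = 1 :> R); [ring|field].
move=> t t01.
have -> : w - (z + w) / 2 = (2^-1 : R)%:C * (w - z).
  by rewrite rmorphV ?unitfE ?pnatr_eq0//= rmorph_nat; field.
have -> : (z + w) / 2 + t%:C * ((2^-1 : R)%:C * (w - z)) =
    z + (2^-1 + t * 2^-1)%:C * (w - z).
  by rewrite rmorphD rmorphM /= rmorphV ?unitfE ?pnatr_eq0//= rmorph_nat; field.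
rewrite mulrCA; apply: pderiv_affine.
apply: dP; lra.
Qed.

End PathIntegral.

(** * Goursat's theorem for bilinear images of the unit square *)

Section Goursat.
Variable R : realType.
Implicit Types (a b h s t e x d : R) (z w : R[i]) (f g : R[i] -> R[i]).

(** The default 0 is taken where no integral exists; elsewhere uniqueness fixes the value. *)
Definition sint f z w : R[i] := xget 0 (segint f z w).

Lemma sintP f z w :
  (forall t, 0 <= t <= 1 -> ccont f (z + t%:C * (w - z))) ->
  segint f z w (sint f z w).
Proof. by move=> /segint_ex; exact: xgetPex. Qed.

Lemma segint_sint f z w v : segint f z w v -> sint f z w = v.
Proof.
move=> Iv; have Is : segint f z w (sint f z w) by apply: xgetPex; exists v.
exact: segint_uniq Is Iv.
Qed.

Lemma sint_split f z w :
  (forall t, 0 <= t <= 1 -> ccont f (z + t%:C * (w - z))) ->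
  sint f z w = sint f z ((z + w) / 2) + sint f ((z + w) / 2) w.
Proof.
move=> /sintP/segint_split[v1 I1 I2].
by rewrite (segint_sint I1) (segint_sint I2) addrC subrK.
Qed.

(** The intervals [[u n, u n + 2^-1 ^+ n]] are nested, so the supremum of their left ends lies in
    all of them. *)
Lemma dyadic_limit (u : nat -> R) :
  (forall n, u n <= u n.+1 <= u n + 2^-1 ^+ n.+1) ->
  exists x, forall n, u n <= x <= u n + 2^-1 ^+ n.
Proof.
move=> H.
have umono n m : (n <= m)%N -> u n <= u m.
  elim: m n => [|m IH] n; first by rewrite leqn0 => /eqP->.
  rewrite leq_eqVlt => /predU1P[->//|/IH h].
  by apply: le_trans h _; case/andP: (H m).
have vmono n m : (n <= m)%N -> u m + 2^-1 ^+ m <= u n + 2^-1 ^+ n.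
  elim: m n => [|m IH] n; first by rewrite leqn0 => /eqP->.
  rewrite leq_eqVlt => /predU1P[->//|/IH]; apply: le_trans.
  have /andP[_ h] := H m.
  have -> : (2^-1 : R) ^+ m = 2^-1 ^+ m.+1 + 2^-1 ^+ m.+1 by rewrite exprS; field.
  by rewrite addrA lerD2r.
have p0 n : 0 <= (2^-1 : R) ^+ n by rewrite exprn_ge0// invr_ge0.
have uv m n : u m <= u n + 2^-1 ^+ n.
  have [/umono h|/ltnW/vmono h] := leqP m n; first by rewrite (le_trans h)// lerDl.
  by apply: le_trans h; rewrite lerDl.
exists (sup (range u)) => n; apply/andP; split.
  by apply: ub_le_sup; [exists (u 0%N + 2^-1 ^+ 0) => _ [m _ <-]|exists n].
by apply: ge_sup; [exists (u 0%N), 0%N|move=> _ [m _ <-]].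
Qed.

Variable f : R[i] -> R[i].
Variables A B C D : R[i].

(** Degenerate coefficients are allowed: collapsing one side to a point gives a triangle. *)
Definition bilin s t : R[i] := A + s%:C * B + t%:C * C + (s * t)%:C * D.

Hypothesis df : forall s t, 0 <= s <= 1 -> 0 <= t <= 1 ->
  exists l, cderiv f (bilin s t) l.

(* Horizontal and vertical segments of the unit square are mapped affinely, so
   the boundary of a subsquare is mapped to four segments. *)
Let hedge s s' t x :
  bilin s t + x%:C * (bilin s' t - bilin s t) = bilin (s + x * (s' - s)) t.
Proof. by rewrite /bilin; ring. Qed.

Let vedge s t t' x :
  bilin s t + x%:C * (bilin s t' - bilin s t) = bilin s (t + x * (t' - t)).
Proof. by rewrite /bilin; ring. Qed.

Let hmid s s' t : (bilin s t + bilin s' t) / 2 = bilin ((s + s') / 2) t.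
Proof. by rewrite /bilin; field. Qed.

Let vmid s t t' : (bilin s t + bilin s t') / 2 = bilin s ((t + t') / 2).
Proof. by rewrite /bilin; field. Qed.

Let conv01 x s s' : 0 <= x <= 1 -> 0 <= s <= 1 -> 0 <= s' <= 1 ->
  0 <= s + x * (s' - s) <= 1.
Proof. by move=> *; nra. Qed.

Let hint s s' t : 0 <= s <= 1 -> 0 <= s' <= 1 -> 0 <= t <= 1 ->
  forall x, 0 <= x <= 1 -> ccont f (bilin s t + x%:C * (bilin s' t - bilin s t)).
Proof.
move=> hs hs' ht x hx; rewrite hedge; have [l dl] := df (conv01 hx hs hs') ht.
exact: cderiv_continuous dl.
Qed.

Let vint s t t' : 0 <= s <= 1 -> 0 <= t <= 1 -> 0 <= t' <= 1 ->
  forall x, 0 <= x <= 1 -> ccont f (bilin s t + x%:C * (bilin s t' - bilin s t)).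
Proof.
move=> hs ht ht' x hx; rewrite vedge; have [l dl] := df hs (conv01 hx ht ht').
exact: cderiv_continuous dl.
Qed.

Let I s t s' t' := sint f (bilin s t) (bilin s' t').

(** This is the integral of [f] around the image of the subsquare with lower left corner [(a, b)]
    and side [h]: bottom and right sides forwards, top and left sides backwards. *)
Let Q a b h := I a b (a + h) b + I (a + h) b (a + h) (b + h)
  - I a (b + h) (a + h) (b + h) - I a b a (b + h).

(** Outer sides split at their midpoints, and each inner side is run through once in either
    direction, so it cancels. *)
Let Qsplit a b h : 0 <= h -> 0 <= a -> a + h <= 1 -> 0 <= b -> b + h <= 1 ->
  Q a b h = Q a b (h / 2) + Q (a + h / 2) b (h / 2) + Q a (b + h / 2) (h / 2)
    + Q (a + h / 2) (b + h / 2) (h / 2).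
Proof.
move=> h0 a0 a1 b0 b1.
have E c : c + h / 2 + h / 2 = c + h by field.
have M c : (c + (c + h)) / 2 = c + h / 2 by field.
have hI t : 0 <= t <= 1 ->
    I a t (a + h) t = I a t (a + h / 2) t + I (a + h / 2) t (a + h) t.
  by move=> ht; rewrite {1}/I sint_split ?hmid ?M//; apply: hint => //; lra.
have vI s : 0 <= s <= 1 ->
    I s b s (b + h) = I s b s (b + h / 2) + I s (b + h / 2) s (b + h).
  by move=> hs; rewrite {1}/I sint_split ?vmid ?M//; apply: vint => //; lra.
have [ha hb hah hbh] : [/\ 0 <= a <= 1, 0 <= b <= 1, 0 <= a + h <= 1 & 0 <= b + h <= 1].
  by split; lra.
rewrite /Q !E (hI b)// (hI (b + h))// (vI a)// (vI (a + h))//.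
do ?[move: (I _ _ _ _) => ?]; ring.
Qed.

Let K := nc B + nc C + 2 * nc D.

(** The product is handled by [s t - s' t' = s (t - t') + t' (s - s')]; this explains the bounds on
    [s] and [t'] and the coefficient 2 of [nc D] in [K]. *)
Let bilin_lip s t s' t' d : 0 <= s <= 1 -> 0 <= t' <= 1 ->
  `|s - s'| <= d -> `|t - t'| <= d -> nc (bilin s t - bilin s' t') <= K * d.
Proof.
move=> hs ht hsd htd.
have -> : bilin s t - bilin s' t' = (s - s')%:C * B + (t - t')%:C * C
    + ((s * (t - t'))%:C * D + (t' * (s - s'))%:C * D).
  by rewrite /bilin; ring.
have k1 : nc ((s * (t - t'))%:C * D) <= nc D * d.
  rewrite ncM nc_real mulrC ler_wpM2l ?nc_ge0// normrM; apply: le_trans htd.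
  by rewrite ler_piMl// ger0_norm; lra.
have k2 : nc ((t' * (s - s'))%:C * D) <= nc D * d.
  rewrite ncM nc_real mulrC ler_wpM2l ?nc_ge0// normrM; apply: le_trans hsd.
  by rewrite ler_piMl// ger0_norm; lra.
have k3 : nc ((s - s')%:C * B) <= nc B * d by rewrite ncM nc_real mulrC ler_wpM2l ?nc_ge0.
have k4 : nc ((t - t')%:C * C) <= nc C * d by rewrite ncM nc_real mulrC ler_wpM2l ?nc_ge0.
have := ncD ((s - s')%:C * B + (t - t')%:C * C)
  ((s * (t - t'))%:C * D + (t' * (s - s'))%:C * D).
have := ncD ((s - s')%:C * B) ((t - t')%:C * C).
have := ncD ((s * (t - t'))%:C * D) ((t' * (s - s'))%:C * D).
rewrite /K; lra.
Qed.

Let K_ge0 : 0 <= K.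
Proof. by rewrite !addr_ge0 ?mulr_ge0 ?nc_ge0. Qed.

(** The remainder is exactly [l / 2 * h ^+ 2]. *)
Let affine_primitive p c l z :
  cderiv (fun z => c * z + l * (z - p) ^+ 2 / 2) z (c + l * (z - p)).
Proof.
move=> e e0; exists (e / (nc l + 1)) => [|h].
  by rewrite divr_gt0// ltr_wpDl// nc_ge0.
rewrite ltr_pdivlMr ?ltr_wpDl ?nc_ge0// => hd.
have -> : c * (z + h) + l * (z + h - p) ^+ 2 / 2 - (c * z + l * (z - p) ^+ 2 / 2) -
     (c + l * (z - p)) * h = (l / 2 * h) * h by field.
rewrite !ncM ler_wpM2r ?nc_ge0//; apply: ltW; apply: le_lt_trans hd.
rewrite mulrC ler_wpM2l ?nc_ge0//.
have -> : nc (2^-1 : R[i]) = 2^-1.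
  by rewrite -[2]/(2%:R) -(rmorph_nat (real_complex R)) -fmorphV nc_real ger0_norm.
have := nc_ge0 l; lra.
Qed.

(* The affine part of [f] at [p] has a primitive, so only the remainder, which
   is [o(h)] on a square of side [h], contributes; its boundary has length
   [O(h)]. *)
Let Q_small s t e : 0 <= s <= 1 -> 0 <= t <= 1 -> 0 < e ->
  exists2 d, 0 < d & forall a b h, 0 <= h -> h < d ->
    0 <= a -> a + h <= 1 -> 0 <= b -> b + h <= 1 ->
    a <= s <= a + h -> b <= t <= b + h -> nc (Q a b h) <= e * h ^+ 2.
Proof.
move=> hs ht e0; have [l] := df hs ht; set p := bilin s t => dl.
(* Each of the four sides will contribute at most [2 * (e' * (K * h) * (K * h))], in total
   [8 * K ^+ 2 * e' * h ^+ 2]; the added 1 keeps the denominator positive when [K = 0]. *)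
have k0 : 0 < 8 * K ^+ 2 + 1 by rewrite ltr_wpDl// mulr_ge0// sqr_ge0.
have k1 : 0 < K + 1 by rewrite ltr_wpDl.
have [d d0 Hd] := dl (e / (8 * K ^+ 2 + 1)) (divr_gt0 e0 k0).
exists (d / (K + 1)) => [|a b h h0]; first by rewrite divr_gt0.
rewrite ltr_pdivlMr// => hd a0 a1 b0 b1 sa tb.
pose g z := f p + l * (z - p).
pose G z := f p * z + l * (z - p) ^+ 2 / 2.
have gG z w : segint g z w (G w - G z).
  by apply: segint_primitive => x _; exact: affine_primitive.
set e' := e / _ in Hd.
have e'0 : 0 <= e' by rewrite ltW// divr_gt0.
(* On one side, [f] differs from its affine part [g] by at most [e' * (K * h)], and the side has
   length at most [K * h]. *)
have est a1' b1' a2 b2 : a <= a1' <= a + h -> b <= b1' <= b + h ->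
   a <= a2 <= a + h -> b <= b2 <= b + h -> a1' = a2 \/ b1' = b2 ->
   nc (I a1' b1' a2 b2 - (G (bilin a2 b2) - G (bilin a1' b1'))) <=
     2 * (e' * (K * h) * (K * h)).
  move=> h1 h2 h3 h4 h5.
  have If : segint f (bilin a1' b1') (bilin a2 b2) (I a1' b1' a2 b2).
    apply: sintP; case: h5 => h5; first by rewrite -h5; apply: vint; lra.
    by rewrite -h5; apply: hint; lra.
  apply: le_trans (segint_norm (segintB If (gG _ _)) (M := e' * (K * h)) _) _.
    move=> x hx.
    have [u [v [-> hu hv]]] : exists u v,
        [/\ bilin a1' b1' + x%:C * (bilin a2 b2 - bilin a1' b1') = bilin u v,
            a <= u <= a + h & b <= v <= b + h].
      case: h5 => h5.
        by exists a2, (b1' + x * (b2 - b1')); rewrite h5 vedge; split => //; nra.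
      by exists (a1' + x * (a2 - a1')), b2; rewrite h5 hedge; split => //; nra.
    have lip : nc (bilin u v - p) <= K * h.
      by apply: bilin_lip; rewrite ?ler_norml; lra.
    have := Hd (bilin u v - p); rewrite (addrC p) subrK => H.
    rewrite (_ : _ - g _ = f (bilin u v) - f p - l * (bilin u v - p));
      last by rewrite /g; ring.
    apply: le_trans (H _) _; last by rewrite ler_wpM2l.
    apply: le_lt_trans lip _; apply: le_lt_trans hd; rewrite mulrC ler_wpM2l//.
    by rewrite lerDl.
  rewrite ler_pM2l// ler_wpM2l//; first by rewrite mulr_ge0// mulr_ge0.
  by apply: bilin_lip; rewrite ?ler_norml; lra.
have aa : a <= a <= a + h by lra.
have ah : a <= a + h <= a + h by lra.
have bb : b <= b <= b + h by lra.
have bh : b <= b + h <= b + h by lra.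
have := est a b (a + h) b aa bb ah bb (or_intror erefl).
have := est (a + h) b (a + h) (b + h) ah bb ah bh (or_introl erefl).
have := est a (b + h) (a + h) (b + h) aa bh ah bh (or_intror erefl).
have := est a b a (b + h) aa bb aa bh (or_introl erefl).
rewrite /Q; set I1 := I _ _ _ _; set I2 := I _ _ _ _; set I3 := I _ _ _ _.
set I4 := I _ _ _ _.
set G1 := G _; set G2 := G _; set G3 := G _; set G4 := G _ => n1 n2 n3 n4.
(* The increments of the primitive [G] cancel around the closed boundary. *)
have -> : I4 + I3 - I2 - I1 =
    (I4 - (G4 - G2)) + (I3 - (G3 - G4)) - ((I2 - (G3 - G1)) + (I1 - (G1 - G2))).
  ring.
apply: (@le_trans _ _ (8 * (e' * (K * h) * (K * h)))); last first.
  have -> : 8 * (e' * (K * h) * (K * h)) = e' * (8 * K ^+ 2) * h ^+ 2 by ring.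
  rewrite ler_wpM2r ?sqr_ge0// /e' mulrAC ler_pdivrMr// ler_wpM2l ?(ltW e0)//.
  by rewrite lerDl.
have := ncD (I4 - (G4 - G2) + (I3 - (G3 - G4))) (- (I2 - (G3 - G1) + (I1 - (G1 - G2)))).
rewrite ncN.
have := ncD (I4 - (G4 - G2)) (I3 - (G3 - G4)).
have := ncD (I2 - (G3 - G1)) (I1 - (G1 - G2)).
lra.
Qed.

(** If the boundary integral had modulus [q > 0], repeated quartering would keep a square of side
    [h n] with integral at least [q * h n ^+ 2], against [Q_small] at the common point of these
    squares. *)
Theorem goursat_bilinear :
  sint f (bilin 0 0) (bilin 1 0) + sint f (bilin 1 0) (bilin 1 1) =
  sint f (bilin 0 1) (bilin 1 1) + sint f (bilin 0 0) (bilin 0 1).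
Proof.
suff : Q 0 0 1 = 0.
  by rewrite /Q /I !add0r => /eqP; rewrite -addrA -opprD subr_eq0 => /eqP.
apply/eqP/negPn/negP => /nc_gt0; set q := nc _ => q0.
pose h n : R := 2^-1 ^+ n.
have h_gt0 n : 0 < h n by rewrite exprn_gt0// invr_gt0.
have hS n : h n.+1 = h n / 2 by rewrite /h exprS mulrC.
pose T n (ab : R * R) := [/\ 0 <= ab.1, ab.1 + h n <= 1, 0 <= ab.2, ab.2 + h n <= 1 &
  q * h n ^+ 2 <= nc (Q ab.1 ab.2 (h n))].
(* The implication makes the statement hold for every pair, as [choice] requires; [(0, 0)] is a
   dummy answer where the invariant [T] fails. *)
have step (x : nat * (R * R)) : exists y : R * R, T x.1 x.2 -> [/\ T x.1.+1 y,
    x.2.1 <= y.1 <= x.2.1 + h x.1.+1 & x.2.2 <= y.2 <= x.2.2 + h x.1.+1].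
  case: x => n [a b] /=.
  have [[/= a0 a1 b0 b1 H]|] := pselect (T n (a, b)); last by exists (0, 0).
  have hn := h_gt0 n.
  have Qs := Qsplit (ltW hn) a0 a1 b0 b1; rewrite -!hS in Qs.
  have hn1 : h n.+1 + h n.+1 = h n by rewrite hS; field.
  have hnn := h_gt0 n.+1.
  have hq : q * h n ^+ 2 =
      q * h n.+1 ^+ 2 + q * h n.+1 ^+ 2 + q * h n.+1 ^+ 2 + q * h n.+1 ^+ 2.
    by rewrite -hn1; ring.
  have a2 : a + h n.+1 + h n.+1 <= 1 by rewrite -addrA hn1.
  have b2 : b + h n.+1 + h n.+1 <= 1 by rewrite -addrA hn1.
  have a3 : a + h n.+1 <= 1 by rewrite (le_trans _ a2)// lerDl ltW.
  have b3 : b + h n.+1 <= 1 by rewrite (le_trans _ b2)// lerDl ltW.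
  have a4 : 0 <= a + h n.+1 by rewrite addr_ge0// ltW.
  have b4 : 0 <= b + h n.+1 by rewrite addr_ge0// ltW.
  have le1 c : c <= c <= c + h n.+1 by rewrite lexx lerDl ltW.
  have le2 c : c <= c + h n.+1 <= c + h n.+1 by rewrite lexx lerDl ltW.
  have [H1|H1] := leP (q * h n.+1 ^+ 2) (nc (Q a b (h n.+1))).
    by exists (a, b).
  have [H2|H2] := leP (q * h n.+1 ^+ 2) (nc (Q (a + h n.+1) b (h n.+1))).
    by exists (a + h n.+1, b).
  have [H3|H3] := leP (q * h n.+1 ^+ 2) (nc (Q a (b + h n.+1) (h n.+1))).
    by exists (a, b + h n.+1).
  (* The first three quarters fall short of their share, so by the triangle inequality the last one
     must reach it. *)
  exists (a + h n.+1, b + h n.+1) => _; split => //; split => //=.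
  move: H; rewrite Qs.
  set x1 := Q a b _ in H1 *; set x2 := Q _ b _ in H2 *; set x3 := Q a _ _ in H3 *.
  set x4 := Q _ _ _.
  have := ncD (x1 + x2 + x3) x4; have := ncD (x1 + x2) x3; have := ncD x1 x2.
  lra.
have [S HS] := choice step.
pose u := nat_rect (fun=> (R * R)%type) (0, 0) (fun n y => S (n, y)).
have Tu n : T n (u n).
  elim: n => [|n IH]; last by have [] := HS (n, u n) IH.
  by split; rewrite /= ?lexx// /h ?expr0 ?add0r// expr1n mulr1.
have [s hs] : exists s, forall n, (u n).1 <= s <= (u n).1 + h n.
  by apply: dyadic_limit => n; have [_ + _] := HS (n, u n) (Tu n).
have [t ht] : exists t, forall n, (u n).2 <= t <= (u n).2 + h n.
  by apply: dyadic_limit => n; have [_ _] := HS (n, u n) (Tu n).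
have s01 : 0 <= s <= 1 by have := hs 0%N; rewrite /= /h expr0 add0r.
have t01 : 0 <= t <= 1 by have := ht 0%N; rewrite /= /h expr0 add0r.
(* The tolerance [q / 2] gives [q * h n ^+ 2 <= q / 2 * h n ^+ 2] once [h n < d], which is
   absurd. *)
have [d d0 Hd] := Q_small s01 t01 (divr_gt0 q0 (ltr0n R 2)).
have [n hn] : exists n, h n < d.
  have : h n @[n --> \oo] --> (0 : R).
    by apply: cvg_expr; rewrite ger0_norm// invf_lt1// ltr1n.
  move=> /cvgrPdist_lt/(_ d d0)[n _ /(_ n (leqnn n))].
  by rewrite sub0r normrN gtr0_norm//; exists n.
have [a0 a1 b0 b1 H] := Tu n.
have := Hd _ _ _ (ltW (h_gt0 n)) hn a0 a1 b0 b1 (hs n) (ht n).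
have : 0 < q * h n ^+ 2 by rewrite mulr_gt0// exprn_gt0.
lra.
Qed.

End Goursat.

(** * Primitives and their uniform continuity on a domain with an affine retraction *)

Section Retract.
Variable R : realType.
Implicit Types (s t e d M : R) (z w p q : R[i]) (f F : R[i] -> R[i]).
Implicit Types (L Omega : set R[i]).

(* For a starlike domain [L] is the star centre and [rho] is constant; for a
   domain of type [*] [L] is a horizontal segment below the graph and [rho] is
   the vertical projection onto its line. *)
Definition retracts Omega L (rho : R[i] -> R[i]) :=
  [/\ L `<=` Omega,
      forall p q t, L p -> L q -> 0 <= t <= 1 -> L (p + t%:C * (q - p)),
      forall z, Omega z -> L (rho z) /\
        forall t, 0 <= t <= 1 -> Omega (rho z + t%:C * (z - rho z)),
      forall z w t, rho (z + t%:C * (w - z)) = rho z + t%:C * (rho w - rho z) &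
      forall z w, nc (rho w - rho z) <= nc (w - z)].

(** The remainder [F (z + h) - F z - f z * h] is the integral of [f - f z] along [[z, z + h]].
    Tolerance [e / 2] for the continuity of [f] absorbs the factor 2 of [segint_norm]. *)
Lemma cderiv_sint Omega f F z :
  (exists2 d, 0 < d & forall w, nc (w - z) < d -> Omega w) ->
  (forall w, Omega w -> ccont f w) ->
  (exists2 d, 0 < d & forall w, nc (w - z) < d -> F w - F z = sint f z w) ->
  cderiv F z (f z).
Proof.
move=> [d1 d10 H1] cf [d2 d20 H2] e e0.
have fz : ccont f z by apply/cf/H1; rewrite subrr nc0.
have [d3 d30 H3] := fz (e / 2) (divr_gt0 e0 (ltr0n R 2)).
exists (Num.min d1 (Num.min d2 d3)); first by rewrite !lt_min d10 d20 d30.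
move=> h; rewrite !lt_min => /and3P[h1 h2 h3].
have zh x : 0 <= x <= 1 -> nc (z + x%:C * (z + h - z) - z) <= nc h.
  move=> /andP[x0 x1]; rewrite (_ : _ - z = x%:C * h); last by ring.
  by rewrite ncM nc_real ler_piMl ?nc_ge0// ger0_norm.
rewrite H2; last by rewrite addrAC subrr add0r.
have Is : segint f z (z + h) (sint f z (z + h)).
  by apply: sintP => x /zh hx; apply/cf/H1/(le_lt_trans hx).
have Ic : segint (fun=> f z) z (z + h) (f z * (z + h) - f z * z).
  apply: (@segint_primitive _ (fun w => f z * w) (fun=> f z)) => x _ e' e'0.
  exists 1 => // k _; rewrite (_ : _ - _ - _ = 0); last by ring.
  by rewrite nc0 mulr_ge0 ?nc_ge0 ?ltW.
have := segint_norm (segintB Is Ic) (M := e / 2).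
rewrite (_ : f z * (z + h) - f z * z = f z * h); last by ring.
rewrite (_ : z + h - z = h); last by ring.
rewrite (_ : 2 * (e / 2 * nc h) = e * nc h); last by field.
apply=> x hx; apply/ltW/H3; apply: le_lt_trans h3.
by have := zh x hx; rewrite (_ : z + h - z = h)//; ring.
Qed.

(** Goursat's theorem is used twice to reduce [F w - F z] to the integral along [[z, w]]: on the
    triangle [p0], [rho z], [rho w] inside [L], and on the quadrilateral [rho z], [rho w], [w],
    [z]. *)
Lemma retracts_primitive Omega L rho f p0 : retracts Omega L rho -> L p0 ->
  (forall z, Omega z -> exists2 d, 0 < d & forall w, nc (w - z) < d -> Omega w) ->
  (forall z, Omega z -> exists l, cderiv f z l) ->
  exists F, forall z, Omega z -> cderiv F z (f z).
Proof.
move=> [LO Lc piO pia pil] Lp0 oO df.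
have cf w : Omega w -> ccont f w by move=> /df[l]; exact: cderiv_continuous.
(* With [B = 0] the bottom side of the square collapses to [p]; convexity of [L] keeps the filled
   triangle inside [Omega]. *)
have tri p q q' : L p -> L q -> L q' -> sint f p q' = sint f q q' + sint f p q.
  move=> Lp Lq Lq'; have := @goursat_bilinear R f p 0 (q - p) (q' - q).
  have E s t : bilin p 0 (q - p) (q' - q) s t = p + t%:C * (q + s%:C * (q' - q) - p).
    by rewrite /bilin; ring.
  rewrite (_ : bilin _ _ _ _ 0 0 = p); last by rewrite E; ring.
  rewrite (_ : bilin _ _ _ _ 1 0 = p); last by rewrite E; ring.
  rewrite (_ : bilin _ _ _ _ 0 1 = q); last by rewrite E; ring.
  rewrite (_ : bilin _ _ _ _ 1 1 = q'); last by rewrite E; ring.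
  have -> : sint f p p = 0.
    apply: segint_sint; exists (fun=> 0); last by rewrite subrr.
    move=> t _ e e0; exists 1 => // h _.
    by rewrite !subrr !mulr0 subrr nc0 mulr_ge0// ltW.
  rewrite add0r; apply=> s t hs ht; rewrite E; apply/df/LO.
  by apply: (Lc _ _ _ Lp _ ht); exact: Lc.
exists (fun z => sint f p0 (rho z) + sint f (rho z) z) => z Oz.
apply: (@cderiv_sint Omega) => //; first exact: oO.
have [d d0 H] := oO z Oz; exists d => // w wz.
have Oseg s : 0 <= s <= 1 -> Omega (z + s%:C * (w - z)).
  move=> /andP[s0 s1]; apply: H; apply: le_lt_trans wz.
  rewrite (_ : _ - z = s%:C * (w - z)); last by ring.
  by rewrite ncM nc_real ler_piMl ?nc_ge0// ger0_norm.
have Ow : Omega w by exact: H.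
have [Lz _] := piO z Oz; have [Lw _] := piO w Ow.
rewrite (tri p0 (rho z) (rho w))//.
(* The coefficients place [bl s t] at parameter [t] on the segment from [rho v] to [v], where
   [v = z + s (w - z)]. That [rho] is affine makes this map bilinear, and each such segment lies in
   [Omega]. *)
have := @goursat_bilinear R f (rho z) (rho w - rho z) (z - rho z) (w - z - rho w + rho z).
set bl := bilin _ _ _ _.
have E s t : bl s t =
    rho (z + s%:C * (w - z)) + t%:C * (z + s%:C * (w - z) - rho (z + s%:C * (w - z))).
  by rewrite /bl /bilin pia; ring.
rewrite (_ : bl 0 0 = rho z); last by rewrite E pia; ring.
rewrite (_ : bl 1 0 = rho w); last by rewrite E pia; ring.
rewrite (_ : bl 0 1 = z); last by rewrite E pia; ring.
rewrite (_ : bl 1 1 = w); last by rewrite E pia; ring.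
move=> G.
rewrite (_ : forall a b c d e : R[i], a + b + c - (b + d) = a + c - d)//; last first.
  by move=> *; ring.
rewrite G ?addrK// => s t hs ht; rewrite E; apply: df.
by have [_] := piO _ (Oseg s hs); exact.
Qed.

Lemma retracts_unif_continuous Omega L rho f F M D : retracts Omega L rho ->
  (forall z, Omega z -> nc z <= D) -> (forall z, Omega z -> nc (f z) <= M) ->
  (forall e, 0 < e -> exists2 d, 0 < d &
    forall z w, Omega z -> Omega w -> nc (z - w) < d -> nc (f z - f w) < e) ->
  (forall z, Omega z -> cderiv F z (f z)) ->
  forall e, 0 < e -> exists2 d, 0 < d &
    forall z w, Omega z -> Omega w -> nc (z - w) < d -> nc (F z - F w) < e.
Proof.
move=> [LO Lc piO pia pil] OD fM uf dF e e0.
have [[z1 Oz1]|nO] := pselect (exists z, Omega z); last first.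
  by exists 1 => // z ? Oz; case: nO; exists z.
have D0 : 0 <= D := le_trans (nc_ge0 _) (OD _ Oz1).
have M0 : 0 <= M := le_trans (nc_ge0 _) (fM _ Oz1).
(* The final bound is [4 * D * k + 6 * M * nc (z - w)] with [k = e / (8 * D + 1)]; these
   denominators make each term at most [e / 2], the second strictly less. *)
have k1 : 0 < 8 * D + 1 by lra.
have k2 : 0 < 12 * M + 1 by lra.
have [d1 d10 H1] := uf (e / (8 * D + 1)) (divr_gt0 e0 k1).
exists (Num.min d1 (e / (12 * M + 1))); first by rewrite lt_min d10 divr_gt0.
move=> z w Oz Ow; rewrite lt_min ltr_pdivlMr// => /andP[h1 h2].
have [Lz Sz] := piO z Oz; have [Lw Sw] := piO w Ow.
pose zt t := rho z + t%:C * (z - rho z); pose wt t := rho w + t%:C * (w - rho w).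
have zw := nc_ge0 (z - w).
have zwt t : 0 <= t <= 1 -> nc (zt t - wt t) <= nc (z - w).
  move=> /andP[t0 t1].
  have -> : zt t - wt t = (1 - t)%:C * (rho z - rho w) + t%:C * (z - w).
    by rewrite /zt /wt; ring.
  apply: le_trans (ncD _ _) _; rewrite !ncM !nc_real !ger0_norm ?subr_ge0//.
  have := pil w z; nra.
pose h t := F (zt t) - F (wt t).
pose h' t := f (zt t) * (z - rho z) - f (wt t) * (w - rho w).
have dh t : 0 <= t <= 1 -> pderiv h t (h' t).
  by move=> ht; apply: pderivB; apply: pderiv_segment; apply: dF; [exact: Sz|exact: Sw].
set k := e / (8 * D + 1) in H1.
have h'k t : 0 <= t <= 1 -> nc (h' t) <= k * (2 * D) + M * (2 * nc (z - w)).
  move=> ht.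
  (* The first product is small by uniform continuity of [f], the second because [f] is bounded and
     [rho] is 1-Lipschitz. *)
  have -> : h' t =
      (f (zt t) - f (wt t)) * (z - rho z) + f (wt t) * ((z - w) - (rho z - rho w)).
    by rewrite /h'; ring.
  apply: le_trans (ncD _ _) _; rewrite !ncM lerD//.
    apply: ler_pM; rewrite ?nc_ge0//.
      by apply/ltW/H1; [exact: Sz|exact: Sw|apply: le_lt_trans h1; exact: zwt].
    have := ncD z (- rho z); rewrite ncN; have := OD _ Oz; have := OD _ (LO _ Lz); lra.
  apply: ler_pM; rewrite ?nc_ge0//; first exact/fM/Sw.
  have := ncD (z - w) (- (rho z - rho w)); rewrite ncN; have := pil w z; lra.
have n1 := pderiv_mean dh h'k.
have n0 : nc (F (rho z) - F (rho w)) <= 2 * (M * nc (z - w)).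
  have I0 : segint f (rho w) (rho z) (F (rho z) - F (rho w)).
    by apply: segint_primitive => t ht; apply/dF/LO/Lc.
  apply: le_trans (segint_norm (M := M) I0 _) _.
    by move=> t ht; apply/fM/LO/Lc.
  by rewrite ler_pM2l// ler_wpM2l.
have -> : F z - F w = (h 1 - h 0) + (F (rho z) - F (rho w)).
  have [zt0 zt1 wt0 wt1] : [/\ zt 0 = rho z, zt 1 = z, wt 0 = rho w & wt 1 = w].
    by split; rewrite /zt /wt; ring.
  by rewrite /h zt0 zt1 wt0 wt1; ring.
apply: le_lt_trans (ncD _ _) _.
have kD : k * (4 * D) <= e / 2.
  rewrite /k mulrAC ler_pdivrMr//; nra.
nra.
Qed.

End Retract.

(** * Compact sets in the plane and extension of uniformly continuous functions *)

Section Compactness.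
Variable R : realType.
Implicit Types (s t e d M D : R) (z w : R[i]) (f g F : R[i]^o -> R[i]^o).
Implicit Types (K Omega : set R[i]^o).

(** Heine-Borel is transferred from [R * R]: [K] is a closed subset of the continuous image of a
    square. *)
Lemma compact_nc K D : closed K -> (forall z, K z -> nc z <= D) -> compact K.
Proof.
move=> cK KD.
pose toC (p : R * R) : R[i]^o := p.1 +i* p.2.
have ctoC : continuous toC.
  move=> [x y] A /nbhs_ncP[d d0 dA].
  have d20 : 0 < d / 2 by rewrite divr_gt0.
  exists (ball x (d / 2), ball y (d / 2)) => /=; first by split; exact: nbhsx_ballx.
  move=> [x' y'] /= [xx yy]; apply: dA; apply: le_lt_trans (nc_le_ReIm _) _.
  move: xx yy; rewrite /ball /= distrC (distrC y); lra.
have : compact (toC @` (`[- D, D] `*` `[- D, D])).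
  apply: continuous_compact; first exact: continuous_subspaceT.
  by apply: compact_setX; exact: segment_compact.
move=> cB; apply: (subclosed_compact cK cB) => z /KD zD.
exists (complex.Re z, complex.Im z); last by case: z {zD}.
split; rewrite /= in_itv /= -ler_norml; apply: le_trans zD.
  exact: normRe_le.
exact: normIm_le.
Qed.

(** In the near-covering form of compactness, a property of [d] and [z] that holds for all small
    [d > 0] locally uniformly in [z] does so uniformly on [K]. *)
Lemma compact_unif_continuous K g : compact K -> {within K, continuous g} ->
  forall e, 0 < e -> exists2 d, 0 < d &
    forall z w, K z -> K w -> nc (z - w) < d -> nc (g z - g w) < e.
Proof.
move=> cK /within_continuous_ncP cg e e0.
have e20 : 0 < e / 2 by rewrite divr_gt0.
move: cK => /compact_near_coveringP cK.
have := cK R (0^'+) (fun d z =>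
  K z -> forall w, K w -> nc (z - w) < d -> nc (g z - g w) < e).
case=> [|d /= d0 H].
  move=> x Kx; have [d d0 H] := cg x Kx _ e20.
  have d20 : 0 < d / 2 by rewrite divr_gt0.
  exists ([set z | nc (z - x) < d / 2], [set s | s < d / 2]) => /=.
    split; first by apply/nbhs_ncP; exists (d / 2).
    exact: nbhs_right_lt.
  move=> [z s] /= [zx sd] Kz w Kw zw.
  have h1 : nc (g z - g x) < e / 2 by apply: H => //; lra.
  have h2 : nc (g w - g x) < e / 2.
    apply: H => //; have := ncD3 w z x; rewrite (ncB w z); lra.
  have := ncD3 (g z) (g x) (g w); rewrite (ncB (g x) (g w)); lra.
exists (d / 2); first by rewrite divr_gt0.
move=> z w Kz Kw zw; apply: (H (d / 2)) => //=; last by rewrite divr_gt0.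
by rewrite sub0r normrN gtr0_norm ?divr_gt0//; move: d0; lra.
Qed.

(** The same covering argument, now with the filter of large bounds. *)
Lemma compact_nc_bounded K g : compact K -> {within K, continuous g} ->
  exists M, forall z, K z -> nc (g z) <= M.
Proof.
move=> cK /within_continuous_ncP cg.
move: cK => /compact_near_coveringP cK.
have := cK R (pinfty_nbhs R) (fun M z => K z -> nc (g z) <= M).
case=> [|M [_ H]].
  move=> x Kx; have [d d0 H] := cg x Kx _ ltr01.
  exists ([set z | nc (z - x) < d], [set s | nc (g x) + 1 <= s]) => /=.
    split; first by apply/nbhs_ncP; exists d.
    by apply: nbhs_pinfty_ge; rewrite num_real.
  move=> [z s] /= [zx sd] Kz; have := H z Kz zx.
  have := ncD (g z - g x) (g x); rewrite subrK; lra.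
by exists (M + 1) => z Kz; apply: (H (M + 1)) => //; rewrite ltrDl.
Qed.

(** Completeness is that of [R]: the real and imaginary parts of [F] are Cauchy along the
    neighbourhoods of [z] traced on [Omega], a proper filter because [z] is in the closure. *)
Lemma unif_continuous_limit Omega F z : closure Omega z ->
  (forall e, 0 < e -> exists2 d, 0 < d &
    forall z w, Omega z -> Omega w -> nc (z - w) < d -> nc (F z - F w) < e) ->
  exists v, forall e, 0 < e -> exists2 d, 0 < d &
    forall w, Omega w -> nc (w - z) < d -> nc (F w - v) < e.
Proof.
move=> cz uF.
have lim_ex (U : R[i]^o -> R) : (forall z w, `|U z - U w| <= nc (F z - F w)) ->
    exists v, U x @[x --> within Omega (nbhs (z : R[i]^o))] --> (v : R).
  move=> UF; apply/cvg_ex.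
  have PF : ProperFilter (within Omega (nbhs (z : R[i]^o))) := within_nbhs_proper cz.
  apply: cauchy_cvg; apply: cauchy_exP => e e0.
  have [d d0 H] := uF e e0; have d20 : 0 < d / 2 by rewrite divr_gt0.
  have [w Ow wz] := (closure_ncP _ _).1 cz _ d20.
  exists (U w); apply/nbhs_ncP; exists (d / 2) => // x xz Ox.
  apply: le_lt_trans (UF _ _) _; apply: H => //.
  have := ncD3 w z x; rewrite (ncB z); lra.
have [u hu] : exists v,
    complex.Re (F x) @[x --> within Omega (nbhs (z : R[i]^o))] --> (v : R).
  by apply: lim_ex => x y; rewrite -ReB normRe_le.
have [v hv] : exists v,
    complex.Im (F x) @[x --> within Omega (nbhs (z : R[i]^o))] --> (v : R).
  by apply: lim_ex => x y; rewrite -ImB normIm_le.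
exists (u +i* v) => e e0; have e20 : 0 < e / 2 by rewrite divr_gt0.
have /cvgrPdist_lt/(_ _ e20)/nbhs_ncP[d1 d10 H1] := hu.
have /cvgrPdist_lt/(_ _ e20)/nbhs_ncP[d2 d20 H2] := hv.
exists (Num.min d1 d2); first by rewrite lt_min d10.
move=> w Ow; rewrite lt_min => /andP[/H1/(_ Ow) h1 /H2/(_ Ow) h2].
apply: le_lt_trans (nc_le_ReIm _) _.
by rewrite ReB ImB (splitr e) ltrD//= distrC.
Qed.

Lemma unif_continuous_extension Omega F :
  (forall e, 0 < e -> exists2 d, 0 < d &
    forall z w, Omega z -> Omega w -> nc (z - w) < d -> nc (F z - F w) < e) ->
  exists2 G : R[i]^o -> R[i]^o, {within closure Omega, continuous G} &
    forall z, Omega z -> G z = F z.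
Proof.
move=> uF.
have /choice[G HG] : forall z : R[i]^o, exists v : R[i]^o, closure Omega z ->
    forall e, 0 < e -> exists2 d, 0 < d &
    forall w, Omega w -> nc (w - z) < d -> nc (F w - v) < e.
  move=> z.
  have [cz|?] := pselect (closure Omega z); last by exists 0.
  by have [v] := unif_continuous_limit cz uF; exists v.
exists G => [|z Oz].
  apply/within_continuous_ncP => z cz e e0.
  have e20 : 0 < e / 2 by rewrite divr_gt0.
  have [d d0 H] := HG z cz _ e20; have d20 : 0 < d / 2 by rewrite divr_gt0.
  (* [G w] and [G z] are compared through [F x] for a point [x] of [Omega] close enough to [w] to
     serve both limits. *)
  exists (d / 2) => // w cw wz; have [d' d'0 H'] := HG w cw _ e20.
  have [|x Ox] := (closure_ncP _ _).1 cw (Num.min d' (d / 2)).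
    by rewrite lt_min d'0.
  rewrite lt_min => /andP[xd' xd].
  have h1 := H' x Ox xd'.
  have h2 : nc (F x - G z) < e / 2.
    by apply: H => //; have := ncD3 x w z; lra.
  have := ncD3 (G w) (F x) (G z); rewrite (ncB (G w) (F x)); lra.
(* For [z] in [Omega] the limit property may be read at [z] itself, so [F z] is within every [e] of
   [G z]. *)
apply/eqP; rewrite eq_sym -subr_eq0; apply/eqP/ComplexField.Normc.eq0_normc/eqP.
rewrite eq_le nc_ge0 andbT; apply/ler_addgt0Pl => e e0; rewrite addr0.
have [d d0] := HG z (subset_closure Oz) e e0; move=> /(_ z Oz).
by rewrite subrr nc0 => /(_ d0)/ltW.
Qed.

End Compactness.

(** * Openness, boundedness and retractions of the two kinds of domains *)

Section Domains.
Variable R : realType.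
Implicit Types (s t e d M D x y : R) (z w p : R[i]) (f F : R[i]^o -> R[i]^o).
Implicit Types (K Omega J : set R[i]^o).

Lemma compact_jordan_curve J : jordan_curve J -> compact J.
Proof.
move=> [gamma [cg _ _ ->]]; apply: continuous_compact => //.
exact: segment_compact.
Qed.

(** A nonempty disc is the union of the segments from its centre to its points, all of which share
    the centre. *)
Lemma connected_disc z d : connected [set w : R[i]^o | nc (w - z) < d].
Proof.
have [d0|d0] := ltP 0 d; last first.
  rewrite (_ : mkset _ = set0); first exact: connected0.
  rewrite -subset0 => w /= wz; have := nc_ge0 (w - z); lra.
pose seg w t : R[i]^o := z + t%:C * (w - z).
rewrite (_ : mkset _ = \bigcup_(w in [set w | nc (w - z) < d]) (seg w @` `[0, 1])).
  apply: bigcup_connected.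
    exists z => w wz /=; exists 0; last by rewrite /seg mul0r addr0.
    by rewrite /= in_itv /= lexx ler01.
  move=> w wz; apply: connected_continuous_connected; first exact: segment_connected.
  apply: continuous_subspaceT => t A /nbhs_ncP[e e0 eA].
  have k0 : 0 < nc (w - z) + 1 by rewrite ltr_wpDl// nc_ge0.
  apply/nbhs_ballP; exists (e / (nc (w - z) + 1)); first exact: divr_gt0.
  move=> s; rewrite /ball /= ltr_pdivlMr// => ts; apply: eA.
  apply: le_lt_trans ts; rewrite /seg.
  rewrite (_ : _ - _ = (s - t)%:C * (w - z)); last by ring.
  by rewrite ncM nc_real distrC ler_wpM2l// lerDl.
apply/seteqP; split=> [w wz|_ [w /= wz [t + <-]]].
  exists w => //; exists 1; first by rewrite /= in_itv /= lexx ler01.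
  by rewrite /seg mul1r (addrC z) subrK.
rewrite /= in_itv /= => /andP[t0 t1]; apply: le_lt_trans wz; rewrite /seg.
rewrite (_ : z + t%:C * (w - z) - z = t%:C * (w - z)); last by ring.
by rewrite ncM nc_real ler_piMl ?nc_ge0// ger0_norm.
Qed.

(** A disc around [z] inside [K] is connected, hence contained in the component of [z]. *)
Lemma open_connected_component K w : open K -> open (connected_component K w).
Proof.
move=> /open_ncP oK; apply/open_ncP => z Cz.
have [d d0 dK] := oK z (connected_component_sub Cz).
exists d => //; rewrite (same_connected_component Cz) => v vz.
apply: (connected_component_max (B := [set v : R[i]^o | nc (v - z) < d])) => //=.
  by rewrite subrr nc0.
exact: connected_disc.
Qed.

Lemma open_jordan_domain Omega : jordan_domain Omega -> open Omega.
Proof.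
move=> [J [hJ [w Jw ->] _]]; apply: open_connected_component.
apply: closed_openC; apply: compact_closed; first exact: norm_hausdorff.
exact: compact_jordan_curve.
Qed.

Lemma bounded_jordan_domain Omega : jordan_domain Omega ->
  exists D, forall z, Omega z -> nc z <= D.
Proof.
(* [bounded_set] provides a bound by every number strictly above [r], hence [r + 1]. *)
move=> [_ [_ _ [M [/complex_realP[r ->] H]]]]; exists (r + 1) => z Oz.
have := H (r + 1)%:C; rewrite ltcR ltrDl ltr01 => /(_ isT z Oz).
by rewrite -lecR -normrE.
Qed.

Lemma starlike_retracts Omega : starlike Omega ->
  exists L rho p, retracts Omega L rho /\ L p.
Proof.
move=> [z0 Oz0 H]; exists [set z0], (fun=> z0), z0; split => //; split.
- by move=> _ ->.
- by move=> _ _ t -> -> _; rewrite /= subrr mulr0 addr0.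
- by move=> z Oz; split => // t t01; exact: H.
- by move=> z w t; rewrite subrr mulr0 addr0.
- by move=> z w; rewrite subrr nc0 nc_ge0.
Qed.

Lemma type_star_retracts Omega : type_star Omega ->
  exists L rho p, retracts Omega L rho /\ L p.
Proof.
move=> [tau [c [ctau _ htau ->]]].
have [m m01 mP] := EVT_min ler01 ctau.
(* The height [y0] is midway between the base [c] and the minimum of [tau], so the horizontal
   segment stays inside the domain. *)
have cm := htau m m01; pose y0 := (c + tau m) / 2.
have y0tau x : 0 < x < 1 -> y0 < tau x.
  move=> /andP[x0 x1]; have x01 : x \in `[0, 1] by rewrite in_itv/= !ltW.
  have := mP x x01; rewrite /y0; lra.
have cy0 : c < y0 by rewrite /y0; lra.
exists [set p | 0 < complex.Re p < 1 /\ complex.Im p = y0].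
exists (fun z => complex.Re z +i* y0), (2^-1 +i* y0).
split; last by split => //=; lra.
split.
- by move=> [x y] /= [x01 ->]; rewrite cy0 y0tau.
- move=> [x1 y1] [x2 y2] t /= [h1 ->] [h2 ->] t01; rewrite !mul0r !subr0 !addr0.
  rewrite subrr mulr0 addr0; split => //.
  by have [h|h] := leP x1 x2; nra.
- move=> [x y] /= [x01 /andP[cy yt]]; split => // t t01.
  rewrite !mul0r !subrr !mulr0 !subr0 !addr0; split => //.
  by have := y0tau x x01; have [h|h] := leP y0 y; nra.
- move=> [x1 y1] [x2 y2] t; apply/eqP; rewrite eq_complex /=.
  by apply/andP; split; apply/eqP; ring.
- move=> z w; apply: le_trans (nc_le_ReIm _) _.
  by rewrite /= subrr normr0 addr0 -ReB normRe_le.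
Qed.

Lemma bounded_type_star Omega : type_star Omega ->
  exists D, forall z, Omega z -> nc z <= D.
Proof.
move=> [tau [c [ctau _ htau ->]]].
have [m m01 mP] := EVT_max ler01 ctau.
exists (1 + (`|c| + `|tau m|)) => -[x y] /= [/andP[x0 x1] /andP[cy yt]].
apply: le_trans (nc_le_ReIm (x +i* y)) _; rewrite /= lerD//.
  by rewrite gtr0_norm// ltW.
have x01 : x \in `[0, 1] by rewrite in_itv/= !ltW.
have h := mP x x01.
have := ler_norm (tau m); have := ler_norm (- c); rewrite normrN.
have := normr_ge0 c; have := normr_ge0 (tau m); rewrite ler_norml; lra.
Qed.

Lemma open_type_star Omega : type_star Omega -> open Omega.
Proof.
move=> [tau [c [ctau _ _ ->]]]; apply/open_ncP => -[x y] /= [/andP[x0 x1] /andP[cy yt]].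
(* With half the gap to the graph, the point rises by less than [e] while [tau] drops by less than
   [e], so they do not meet. *)
pose e := (tau x - y) / 2; have e0 : 0 < e by rewrite divr_gt0// subr_gt0.
have x01 : `[0, 1]%classic x by rewrite /= in_itv/= !ltW.
have /cvgrPdist_lt/(_ e e0)/nbhs_ballP[d /= d0 H] :=
  (subspace_continuousP _ _).1 ctau x x01.
exists (Num.min d (Num.min e (Num.min (y - c) (Num.min x (1 - x))))).
  by rewrite !lt_min d0 e0 !subr_gt0 cy x0.
move=> [x' y']; rewrite !lt_min => /and5P[h1 h2 h3 h4 h5].
have hx : `|x' - x| <= nc ((x' +i* y') - (x +i* y)) := normRe_le ((x' +i* y') - (x +i* y)).
have hy : `|y' - y| <= nc ((x' +i* y') - (x +i* y)) := normIm_le ((x' +i* y') - (x +i* y)).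
have x'0 : 0 < x' by move: hx; rewrite ler_norml; lra.
have x'1 : x' < 1 by move: hx; rewrite ler_norml; lra.
have cy' : c < y' by move: hy; rewrite ler_norml; lra.
have := H x'; rewrite /ball /= in_itv /= (ltW x'0) (ltW x'1) distrC.
move=> /(_ (le_lt_trans hx h1) isT).
rewrite x'0 x'1 cy' ltr_norml => /andP[_ h]; split => //.
have {}h : tau x - tau x' < e by [].
move: hy; rewrite ler_norml; rewrite /e in h h2 *; lra.
Qed.

(** On [Omega], [f] inherits boundedness and uniform continuity from its continuous extension [g] to
    the compact closure. *)
Lemma antiderivative_A_of Omega L rho p D f :
  retracts Omega L rho -> L p -> open Omega ->
  (forall z, Omega z -> nc z <= D) -> A_of Omega f ->
  (exists F : R[i]^o -> R[i]^o, antiderivative_on Omega f F) /\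
  (forall F : R[i]^o -> R[i]^o, antiderivative_on Omega f F -> A_of Omega F).
Proof.
move=> rO Lp /open_ncP oO OD [hf [g cg gf]]; split.
  have [|F dF] := retracts_primitive rO Lp oO (f := f).
    by move=> z /hf/derivable_cderiv df; exists ('D_1 f z).
  by exists F; split=> z /dF/cderiv_is_derive[].
move=> F [hF DF]; split => //; apply: unif_continuous_extension.
have cK : compact (closure Omega).
  (* Every point of the closure is within distance 1 of a point of [Omega]. *)
  apply: (@compact_nc _ _ (D + 1)); first exact: closed_closure.
  move=> z /closure_ncP/(_ 1 ltr01)[w /OD wD wz].
  have := ncD (z - w) w; rewrite subrK (ncB z); lra.
have [M gM] := compact_nc_bounded cK cg.
have ug := compact_unif_continuous cK cg.
have cl := @subset_closure _ Omega.
apply: (retracts_unif_continuous (f := f) (M := M) rO OD).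
- by move=> z Oz; rewrite -gf//; exact/gM/cl.
- move=> e /ug[d d0 H]; exists d => // z w Oz Ow zw.
  by rewrite -!gf//; apply: H => //; exact: cl.
- by move=> z Oz; rewrite -DF//; exact/derivable_cderiv/hF.
Qed.

End Domains.

Theorem proposition6p2 (R : realType) (Omega : set R[i]^o)
  (hOmega : (jordan_domain Omega /\ starlike Omega) \/ type_star Omega)
  (f : R[i]^o -> R[i]^o) (hf : A_of Omega f) :
  (exists F : R[i]^o -> R[i]^o, antiderivative_on Omega f F) /\
  (forall F : R[i]^o -> R[i]^o, antiderivative_on Omega f F -> A_of Omega F).
Proof.
have [L [rho [p [rO Lp]]]] : exists L rho p, retracts Omega L rho /\ L p.
  by case: hOmega => [[_ /starlike_retracts]|/type_star_retracts].
have oO : open Omega.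
  by case: hOmega => [[/open_jordan_domain]|/open_type_star].
have [D OD] : exists D, forall z, Omega z -> nc z <= D.
  by case: hOmega => [[/bounded_jordan_domain]|/bounded_type_star].
exact: antiderivative_A_of rO Lp oO OD hf.
Qed.
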